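(* For $n\ge1$ let $C_n(t)=\sum_{w\in\{0,1\}^n}t^{\mathrm{des}(\mathrm{runsort}(w))}$. Then \[ C_n(t)=\binom{n+1}{3}+(n+1)+\sum_{k=2}^{n}t^{k-1}\left(\binom{n}{2k}+\binom{n}{2k+1}\right). \] In particular, the number of binary words of length $n$ with no descents after run-sorting is $\binom{n+1}{3}+n+1$.
   Context: For a word $w=w(1)\dotsm w(n)$ over $\{0,1\}$, $k\in[n-1]$ is a descent if $w(k)>w(k+1)$ and $\mathrm{des}(w)$ is the number of descents. The runs of $w$ are its maximal weakly increasing contiguous subwords, and $\mathrm{runsort}(w)$ is the word obtained by rearranging the runs of $w$ in lexicographic order. Binomial coefficients $\binom{n}{j}$ are $0$ for $j>n$. *)

(* Defs.v *)
From HB Require Import structures.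
From mathcomp Require Import all_boot all_order all_algebra.

Set Implicit Arguments.
Unset Strict Implicit.
Unset Printing Implicit Defensive.

Import Order.TTheory GRing.Theory Num.Theory.
Local Open Scope ring_scope.

(* A binary word is a [seq bool], the letter 0 being [false] and the letter 1
   being [true]; the order of [bool] is [false < true]. *)

(* [nth] is 0-based, so i stands for the position k = i + 1 in [n - 1]. *)
Definition des (w : seq bool) : nat :=
  #|[set i : 'I_(size w).-1 |
      (nth false w i.+1 < nth false w i)%O]|.

Fixpoint runs (w : seq bool) : seq (seq bool) :=
  if w is x :: w' then
    match runs w' with
    | (y :: r) :: rs =>
        if (x <= y)%O then (x :: y :: r) :: rs else [:: x] :: (y :: r) :: rs
    | rs => [:: x] :: rs
    end
  else [::].

(* The type [seqlexi bool] carries the dictionary order, in which a proper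
   prefix of a word is smaller than the word. *)
Definition runsort (w : seq bool) : seq bool :=
  flatten (sort (fun r s : seqlexi bool => (r <= s)%O) (runs w)).

Definition C (n : nat) : {poly int} :=
  \sum_(w : n.-tuple bool) 'X^(des (runsort w)).

(* The next lemmas check that [runs w] is the factorization of w into maximal
   weakly increasing factors. *)
Lemma flatten_runs (w : seq bool) : flatten (runs w) = w.
Proof.
elim: w => //= x w; case: (runs w) => [|[|y r] rs] /= <- //.
by case: ifP.
Qed.

Lemma runs_nonempty (w : seq bool) : [::] \notin runs w.
Proof.
elim: w => //= x w; case: (runs w) => [|[|y r] rs] //=.
by rewrite inE => h; case: ifP; rewrite !inE.
Qed.

Lemma runs_sorted (w : seq bool) : all (sorted <=%O) (runs w).
Proof.
elim: w => //= x w; case: (runs w) => [|[|y r] rs] //=.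
by case: ifP => //= -> .
Qed.

Lemma runs_maximal (w : seq bool) :
  sorted (fun r s => (head false s < last false r)%O) (runs w).
Proof.
elim: w => //= x w; have := runs_nonempty w.
case: (runs w) => [|[|y r] rs] //= _ IH.
by case: leP => //= hyx; [case: rs IH | rewrite hyx].
Qed.

(* Main.v *)
(* A run of a binary word is [0^i 1^j].  If r <= s lexicographically then the
   first (resp. last) letter of r is at most that of s, so run-sorting puts the
   runs [0^i] first, then the mixed runs (i, j > 0), then the runs [1^j], and a
   descent occurs exactly between two consecutive mixed runs.  The mixed runs of
   w correspond to the occurrences of the factor 01 in w, so w contributes
   [t^(m-1)] if it has m > 0 occurrences of 01, and [1] if it has none.  Words
   of length n with m occurrences of 01 are counted by binom(n+1, 2m+1), by
   Pascal's rule applied simultaneously to the words preceded by 0 and by 1. *)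
Require Import Defs.
From HB Require Import structures.
From mathcomp Require Import all_boot all_order all_algebra.

Import Order.TTheory GRing.Theory Num.Theory.
Local Open Scope ring_scope.

Lemma des_cons2 (x y : bool) (w : seq bool) :
  des (x :: y :: w) = ((x && ~~ y) + des (y :: w))%N.
Proof.
rewrite /des -!sum1dep_card !big_mkcond /= big_ord_recl /=; congr addn.
  by case: x; case: y.
by rewrite [RHS]big_mkcond.
Qed.

Lemma des_seq1 (x : bool) : des [:: x] = 0%N.
Proof. by apply/eqP; rewrite cards_eq0; apply/eqP/setP => -[]. Qed.

Lemma des_nil : des [::] = 0%N.
Proof. by apply/eqP; rewrite cards_eq0; apply/eqP/setP => -[]. Qed.

(** A weakly increasing factor has no inner descent, so only the junction matters. The default
    [true] for the head of an empty [w] makes that term vanish when nothing follows. *)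
Lemma des_cat_sorted (x : bool) (r w : seq bool) : sorted <=%O (x :: r) ->
  des (x :: r ++ w) = ((last x r && ~~ head true w) + des w)%N.
Proof.
elim: r x => [|y r IH] x /=.
  by case: w => [|y w] _; rewrite ?des_cons2 // des_seq1 des_nil andbF.
by case/andP => le_xy srt; rewrite des_cons2 IH //; case: x y le_xy {IH srt} => [] [].
Qed.

(* Number of occurrences of the factor 01 in [b :: w]. *)
Fixpoint asc (b : bool) (w : seq bool) : nat :=
  if w is x :: w' then (~~ b && x) + asc x w' else 0.

Lemma asc_size (b : bool) (w : seq bool) : (asc b w <= size w)%N.
Proof. by elim: w b => //= x w IH b; rewrite -add1n leq_add ?leq_b1. Qed.

Definition mixed (r : seq bool) : bool := ~~ head true r && last false r.

Lemma last_sorted_true (r : seq bool) : sorted <=%O (true :: r) -> last true r.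
Proof. by elim: r => //= -[]. Qed.

(** A mixed run contains 01 exactly once, other runs never, and no occurrence straddles two runs,
    which meet at a descent. The preceding letter [true] creates no occurrence. *)
Lemma count_mixed_runs (w : seq bool) : count mixed (runs w) = asc true w.
Proof.
elim: w => //= x w IH.
have := flatten_runs w; have := runs_sorted w; have := runs_nonempty w.
move: IH; case: (runs w) => [|[|y r] rs] //=; first by move=> _ _ _ <-; case: x.
move=> IH _ /andP[srt _] Ew; move: IH; rewrite -Ew /= => IH.
case: x; case: y srt IH {Ew} => srt IH /=; rewrite /mixed /= in IH *;
  rewrite -?IH ?last_sorted_true //.
by move: IH; rewrite !add0n => ->.
Qed.

(** If the second word begins with 1, it ends with 1. Otherwise the first begins with 0 too, and
    stripping both zeros leaves a comparison of shorter words. *)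
Lemma last_lexi (x y : bool) (r s : seq bool) :
  sorted <=%O (x :: r) -> sorted <=%O (y :: s) ->
  ((x :: r : seqlexi bool) <= y :: s)%O -> last x r ==> last y s.
Proof.
elim: r x y s => [|x' r IH] x y s sr ss; rewrite lexi_cons.
  case: y ss => [/last_sorted_true /= ->|_]; first by rewrite implybT.
  by case: x {sr}.
case: y ss => [/last_sorted_true /= ->|]; first by rewrite implybT.
case: x sr => // /andP[_ sr]; case: s => // y' s /andP[_ ss] /=.
exact: IH.
Qed.

(** This weakening of the lexicographic order on runs is all that the descent count uses of the
    sorting. *)
Definition dominated (r s : seq bool) : bool :=
  (head true r ==> head true s) && (last false r ==> last false s).

Lemma dominated_trans : transitive dominated.
Proof.
move=> s r t /andP[/implyP h1 /implyP l1] /andP[/implyP h2 /implyP l2].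
by apply/andP; split; apply/implyP; [move/h1/h2 | move/l1/l2].
Qed.

Lemma lexi_dominated (r s : seqlexi bool) :
  [::] != r :> seq bool -> [::] != s :> seq bool ->
  sorted <=%O (r : seq bool) -> sorted <=%O (s : seq bool) -> (r <= s)%O ->
  dominated r s.
Proof.
case: r s => [|x r] [|y s] // _ _ sr ss le_rs; rewrite /dominated /= last_lexi // andbT.
by move: le_rs; rewrite lexi_cons => /andP[]; case: x {sr}; case: y {ss}.
Qed.

Lemma des_flatten (rs : seq (seq bool)) :
  [::] \notin rs -> all (sorted <=%O) rs -> sorted dominated rs ->
  des (flatten rs) = (count mixed rs).-1.
Proof.
elim: rs => [|[|x r] rs IH]; rewrite ?inE //; first by rewrite des_nil.
move=> nn /andP[sr srs] dom.
rewrite [flatten _]/= des_cat_sorted // IH ?(path_sorted dom) //.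
case: rs nn dom {IH sr srs} => [|[|y s] rs] //; first by rewrite /= andbF addn0; case: mixed.
move=> _ /= /andP[/andP[/= hxy lxy] dom].
(* If the next run begins with 1, so do all later ones: no mixed run remains, and the junction is
   not a descent. *)
case: y hxy lxy dom => /= hxy lxy dom.
  have -> : count mixed rs = 0%N.
    apply/eqP; rewrite -leqn0 leqNgt -has_count; apply/hasPn => t t_rs.
    have /allP/(_ t t_rs) := order_path_min dominated_trans dom.
    by rewrite /mixed => /andP[/= -> _].
  by rewrite andbF addn0; case: (mixed (x :: r)).
(* Both runs now begin with 0. If the first ends with 1, so does the second; the remaining count is
   then positive and its predecessor is not truncated. *)
case: x hxy lxy => // _; rewrite /mixed /=.
by case: (last false r) => //= ->.
Qed.

Lemma des_runsort (w : seq bool) : des (runsort w) = (asc true w).-1.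
Proof.
rewrite /runsort; set le := (fun r s : seqlexi bool => _).
have ps : perm_eq (sort le (runs w)) (runs w) by rewrite perm_sort.
have srt : sorted le (sort le (runs w)) by apply: sort_sorted => x y; apply: le_total.
have nn : [::] \notin sort le (runs w) by rewrite (perm_mem ps) runs_nonempty.
have al : all (sorted <=%O) (sort le (runs w)) by rewrite (perm_all _ ps) runs_sorted.
rewrite des_flatten //.
  by have /permP -> := ps; rewrite count_mixed_runs.
apply: (sub_in_sorted (P := fun r => ([::] != r) && sorted <=%O r)) srt.
  by move=> r s /andP[r0 rs] /andP[s0 ss]; apply: lexi_dominated.
apply/allP => r rin; rewrite (allP al) // andbT.
by apply: contraNneq nn => ->.
Qed.

Lemma sum_tuple_cons (n : nat) (F : seq bool -> nat) :
  (\sum_(w : n.+1.-tuple bool) F w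
   = \sum_(w : n.-tuple bool) F (false :: w)
     + \sum_(w : n.-tuple bool) F (true :: w))%N.
Proof.
rewrite addnC -(big_bool addn (fun b => \sum_(w : n.-tuple bool) F (b :: w)))%N.
rewrite pair_big /=.
rewrite (reindex (fun p : bool * n.-tuple bool => cons_tuple p.1 p.2)) //=.
exists (fun w => (thead w, behead_tuple w)) => [[b w] _|w _] /=.
  by congr pair; apply: val_inj.
by rewrite [RHS]tuple_eta; apply: val_inj.
Qed.

Lemma sum_asc (n : nat) (b : bool) (m : nat) :
  (\sum_(w : n.-tuple bool) (asc b w == m))%N = 'C(n.+1, m.*2 + b).
Proof.
elim: n b m => [|n IH] b m.
  rewrite (big_pred1 [tuple]) /=; last by move=> w; apply/esym/eqP/tuple0.
  by case: m => [|m]; case: b => //=; rewrite bin_small // doubleS.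
rewrite (sum_tuple_cons _ (fun w => asc b w == m :> nat)) /= andbF andbT.
under eq_bigr do rewrite add0n.
rewrite IH addn0.
(* Words with first letter 0 have given binom(n+1, 2m). After a 1, a first letter 1 adds no
   occurrence, and Pascal's rule concludes. *)
case: b => /=.
  by under eq_bigr do rewrite add0n; rewrite IH addn1 binS addnC.
(* After a 0, a first letter 1 is itself an occurrence: impossible for m = 0, and otherwise one
   fewer is left for the rest. *)
case: m => [|m].
  by rewrite big1 // !bin0.
under eq_bigr do rewrite add1n eqSS.
by rewrite IH addn0 addn1 doubleS binS.
Qed.

Lemma card_asc (n : nat) (m : nat) :
  #|[set w : n.-tuple bool | asc true w == m]| = 'C(n.+1, m.*2.+1).
Proof.
by rewrite -sum1dep_card big_mkcond /= -[m.*2.+1]addn1 -(sum_asc n true).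
Qed.

Theorem theorem5p10 (n : nat) (n_ge1 : (1 <= n)%N) :
  C n = ('C(n.+1, 3) + n.+1)%N%:R
        + \sum_(2 <= k < n.+1)
            ('C(n, 2 * k) + 'C(n, 2 * k + 1))%N%:R *: 'X^(k - 1)
  /\ #|[set w : n.-tuple bool | des (runsort w) == 0%N]|
     = ('C(n.+1, 3) + n.+1)%N.
Proof.
have asc_lt (w : n.-tuple bool) : (asc true w < n.+1)%N.
  by rewrite ltnS -[X in (_ <= X)%N](size_tuple w) asc_size.
split.
  rewrite /C (partition_big (fun w => Ordinal (asc_lt w)) xpredT) //=.
  transitivity (\sum_(m < n.+1) ('C(n.+1, m.*2.+1))%:R *: 'X^(m.-1) : {poly int}).
    apply: eq_bigr => m _; rewrite -card_asc scaler_nat -sumr_const.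
    apply: eq_big => [w|w /eqP <-]; first by rewrite inE -val_eqE.
    by rewrite des_runsort.
  rewrite -(big_mkord xpredT (fun m => ('C(n.+1, m.*2.+1))%:R *: 'X^(m.-1))).
  (* The terms for 0 and 1 occurrences both have exponent 0 and form the constant term; the second
     exists because n >= 1. *)
  rewrite big_ltn //; rewrite big_ltn; last by rewrite ltnS.
  rewrite addrA; congr (_ + _).
    rewrite expr0 bin1 -scalerDl -natrD addnC.
    by rewrite scaler_nat.
  apply: eq_bigr => k _; rewrite subn1 mul2n addn1 addnC.
  by rewrite binS.
have -> : [set w : n.-tuple bool | des (runsort w) == 0%N]
  = [set w : n.-tuple bool | asc true w == 1%N]
    :|: [set w : n.-tuple bool | asc true w == 0%N].
  by apply/setP => w; rewrite !inE des_runsort; case: (asc true w) => [|[]].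
rewrite cardsU disjoint_setI0 ?cards0 ?subn0 ?card_asc ?bin1 //.
by rewrite -setI_eq0; apply/eqP/setP => w; rewrite !inE; case: (asc true w) => [|[]].
Qed.
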